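(* The distribution $\lambda(x,\xi,t)=e^{-|x-t\xi|^2-|\xi|^2}$ on $\mathbb{R}^n\times\mathbb{R}^n\times[0,\infty)$ is a scattering frame for the hard-sphere Boltzmann collision operator, and its isotropic radius $\alpha$ satisfies $$\frac{1}{4V_{n-1}\Omega}\le\alpha,$$ where $V_{n-1}$ is the volume of the $(n-1)$-dimensional unit sphere $S^{n-1}$ and $$\Omega=\sup_{x,\xi}\int_0^\infty\int_{\mathbb{R}^n}e^{-|x+s\xi-s\xi_*|^2-|\xi_*|^2}|\xi-\xi_*|\,d\xi_*\,ds.$$
   Context: Here $x,\xi\in\mathbb{R}^n$, $t\in[0,\infty)$, $\chi_D$ is the indicator function of $D$, and the linear transport equation is $\partial_t g+\xi\cdot\nabla_x g=0$. Hard-sphere collision operator: for $\mathbf n\in S^{n-1}$ put $\xi'=\xi-(\mathbf n\cdot(\xi-\xi_* ))\mathbf n$, $\xi'_*=\xi_*+(\mathbf n\cdot(\xi-\xi_* ))\mathbf n$, and $f=f(x,\xi,t)$, $f_*=f(x,\xi_*,t)$, $f'=f(x,\xi',t)$, $f'_*=f(x,\xi'_*,t)$ (similarly for $g$). The gain and loss terms are $$Q^+(f,g)=\tfrac12\int_{\mathbb{R}^n}\int_{S^{n-1}}(f'g'_*+g'f'_* )\,|\mathbf n\cdot(\xi'-\xi'_* )|\,d\mathbf n\,d\xi_*,$$ $$Q^-(f,g)=\tfrac12\int_{\mathbb{R}^n}\int_{S^{n-1}}(f_*g+g_*f)\,|\mathbf n\cdot(\xi-\xi_* )|\,d\mathbf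 n\,d\xi_*.$$ Scattering frame: a solution $\lambda(x,\xi,t)$ of the linear transport equation such that $$\sup_{x,\xi}\frac{1}{\lambda(x,\xi,0)}\int_0^\infty Q^+(\lambda,\lambda)(x+t\xi,\xi,t)\,dt+\sup_{x,\xi}\frac{1}{\lambda(x,\xi,0)}\int_0^\infty Q^-(\lambda,\lambda)(x+t\xi,\xi,t)\,dt<\infty$$ and, for every bounded $D\subset\mathbb{R}^n$, $$\lim_{z\to\infty}\Big(\sup_{x,\xi}\frac{\chi_D(x)}{\lambda(x,\xi,0)}\int_z^\infty Q^+(\lambda,\lambda)(x+t\xi,\xi,t)\,dt+\sup_{x,\xi}\frac{\chi_D(x)}{\lambda(x,\xi,0)}\int_z^\infty Q^-(\lambda,\lambda)(x+t\xi,\xi,t)\,dt\Big)=0.$$ Isotropic radius: $\alpha$ is defined by $$0<\frac1{2\alpha}=\sup_{x,\xi}\frac{1}{\lambda(x,\xi,0)}\int_0^\infty Q^+(\lambda,\lambda)(x+t\xi,\xi,t)\,dt+\sup_{x,\xi}\frac{1}{\lambda(x,\xi,0)}\int_0^\infty Q^-(\lambda,\lambda)(x+t\xi,\xi,t)\,dt<\infty.$$ *)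

(* Defs.v *)
From HB Require Import structures.
From mathcomp Require Import all_boot all_order all_algebra.
From mathcomp Require Import all_classical all_reals all_analysis.
From mathcomp Require Import measurable_realfun.

Set Implicit Arguments.
Unset Strict Implicit.
Unset Printing Implicit Defensive.

Import Order.TTheory GRing.Theory Num.Theory.
Import numFieldNormedType.Exports.

Local Open Scope classical_set_scope.
Local Open Scope ring_scope.

(* The product sigma-algebra on row vectors, generated by the coordinates, as  *)
(* the library does for n.-tuple T. On 'rV[R]_n it is the Borel sigma-algebra. *)

Definition measure_rV_display : measure_display -> measure_display.
Proof. exact. Qed.

Section measurable_rV.
Context {d} {T : measurableType d}.
Variable n : nat.

Let coors : 'I_n -> 'rV[T]_n -> T := fun i v => v ord0 i.

Let rV_set0 : g_sigma_preimage coors set0.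
Proof. exact: sigma_algebra0. Qed.

Let rV_setC A : g_sigma_preimage coors A -> g_sigma_preimage coors (~` A).
Proof. exact: sigma_algebraC. Qed.

Let rV_bigcup (F : _^nat) : (forall i, g_sigma_preimage coors (F i)) ->
  g_sigma_preimage coors (\bigcup_i (F i)).
Proof. exact: sigma_algebra_bigcup. Qed.

HB.instance Definition _ := @isMeasurable.Build (measure_rV_display d)
  'rV[T]_n (g_sigma_preimage coors) rV_set0 rV_setC rV_bigcup.

End measurable_rV.

Lemma measurable_coord d (T : measurableType d) n (i : 'I_n) :
  measurable_fun [set: 'rV[T]_n] (fun v => v ord0 i).
Proof.
move=> _ Y mY; rewrite setTI; apply: sub_sigma_algebra => /=.
rewrite -bigcup_seq/=; exists i => /=; first by rewrite mem_index_enum.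
by exists Y => //; rewrite setTI.
Qed.

Lemma measurable_fun_rV d1 d2 (T1 : measurableType d1) (T2 : measurableType d2)
    n (f : T1 -> 'rV[T2]_n) :
  (forall i, measurable_fun [set: T1] (fun x => f x ord0 i)) ->
  measurable_fun [set: T1] f.
Proof.
move=> mf _ B mB; rewrite setTI.
have : g_sigma_preimage (fun i x => f x ord0 i) `<=` measurable.
  apply: smallest_sub; first exact: sigma_algebra_measurable.
  case: n f mf B mB => [|n] f mf B mB; first by rewrite big_ord0.
  rewrite -bigcup_mkord_ord; apply: bigcup_sub => i _ A [C mC <-].
  exact: mf.
apply.
rewrite -[X in X _]/(g_sigma_preimage (fun i => (fun v : 'rV_n => v ord0 i) \o f)).
by rewrite g_sigma_preimage_comp; exists B => //; rewrite setTI.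
Qed.

Section lebesgue_rV.
Context {R : realType}.
Local Open Scope ereal_scope.

Definition rV_cons n (p : measurableTypeR R * 'rV[R]_n) : 'rV[R]_n.+1 :=
  \row_i oapp (p.2 ord0) p.1 (unlift ord0 i).

Definition rV_uncons n (v : 'rV[R]_n.+1) : measurableTypeR R * 'rV[R]_n :=
  (v ord0 ord0, \row_i v ord0 (lift ord0 i)).

Lemma rV_consK n : cancel (@rV_cons n) (@rV_uncons n).
Proof.
move=> [x v]; congr pair; first by rewrite mxE unlift_none.
by apply/rowP => i; rewrite !mxE liftK.
Qed.

Lemma rV_unconsK n : cancel (@rV_uncons n) (@rV_cons n).
Proof.
move=> v; apply/rowP => i; rewrite mxE.
by case: unliftP => [j ->|->] //=; rewrite mxE.
Qed.

Lemma measurable_rV_cons n : measurable_fun setT (@rV_cons n).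
Proof.
apply: measurable_fun_rV => i.
case: (unliftP ord0 i) => [j ->|->].
  have -> : (fun p => @rV_cons n p ord0 (lift ord0 j)) =
      (fun v : 'rV[R]_n => v ord0 j) \o snd.
    by apply/funext => p /=; rewrite mxE liftK.
  exact: measurableT_comp (measurable_coord j) measurable_snd.
have -> : (fun p => @rV_cons n p ord0 ord0) = fst.
  by apply/funext => p /=; rewrite mxE unlift_none.
exact: measurable_fst.
Qed.

Lemma measurable_rV_uncons n : measurable_fun setT (@rV_uncons n).
Proof.
apply/measurable_fun_pairP; split; first exact: measurable_coord.
apply: measurable_fun_rV => i.
have -> : (fun v => (snd \o @rV_uncons n) v ord0 i) =
    (fun v : 'rV[R]_n.+1 => v ord0 (lift ord0 i)).
  by apply/funext => v /=; rewrite mxE.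
exact: measurable_coord.
Qed.

Section lebesgue_rVS.
Variables (n : nat) (m : {sigma_finite_measure set 'rV[R]_n -> \bar R}).

Definition lebesgue_rVS : set 'rV[R]_n.+1 -> \bar R :=
  pushforward (lebesgue_measure \x m) (@rV_cons n).



Let rVS0 : lebesgue_rVS set0 = 0.
Proof. by unshelve apply: measure0; exact: measurable_rV_cons. Qed.

Let rVS_ge0 A : 0 <= lebesgue_rVS A.
Proof. by unshelve apply: measure_ge0; exact: measurable_rV_cons. Qed.

Let rVS_sigma_additive : semi_sigma_additive lebesgue_rVS.
Proof.
by unshelve apply: measure_semi_sigma_additive; exact: measurable_rV_cons.
Qed.

HB.instance Definition _ := isMeasure.Build _ _ _ lebesgue_rVS
  rVS0 rVS_ge0 rVS_sigma_additive.

Let rVS_sigma_finite : sigma_finite setT lebesgue_rVS.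
Proof.
have /sigma_finiteP[F [TF ndF Foo]] := sigma_finiteT (@lebesgue_measure R).
have /sigma_finiteP[G [TG ndG Goo]] := sigma_finiteT m.
exists (fun k => @rV_uncons n @^-1` (F k `*` G k)).
  rewrite -preimage_bigcup -[LHS](preimage_setT (@rV_uncons n)).
  congr (_ @^-1` _); rewrite -setXTT TF TG predeqE => -[x y]; split.
    move=> [/= [k _ Fkx] [l _ Gly]]; exists (maxn k l) => //; split.
    - by move: x Fkx; exact/subsetPset/ndF/leq_maxl.
    - by move: y Gly; exact/subsetPset/ndG/leq_maxr.
  by move=> [k _ []/= ? ?]; split; exists k.
move=> k; have [mF Fk] := Foo k; have [mG Gk] := Goo k; split.
  by rewrite -[X in measurable X]setTI; apply: measurable_rV_uncons => //;
    exact: measurableX.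
rewrite /lebesgue_rVS /pushforward -comp_preimage.
rewrite (_ : _ \o _ = id); last by apply/funext => p; exact: rV_consK.
by rewrite preimage_id product_measure1E// lte_mul_pinfty// ge0_fin_numE.
Qed.

HB.instance Definition _ := Measure_isSigmaFinite.Build _ _ _ lebesgue_rVS
  rVS_sigma_finite.

End lebesgue_rVS.

Fixpoint lebesgue_rV n : {sigma_finite_measure set 'rV[R]_n -> \bar R} :=
  if n is k.+1 then lebesgue_rVS (lebesgue_rV k) else \d_(0%R : 'rV[R]_0).

End lebesgue_rV.

Section sphere.
Context {R : realType} (n : nat).
Implicit Types x y : 'rV[R]_n.

Definition dot x y : R := \sum_(i < n) x ord0 i * y ord0 i.

(* The norm of the library on 'rV[R]_n is the sup norm. *)
Definition enorm x : R := Num.sqrt (dot x x).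

Definition sphere : set 'rV[R]_n := [set x | enorm x = 1].

Definition punctured_ball : set 'rV[R]_n := [set x | 0 < enorm x <= 1].

Definition normalize x : 'rV[R]_n := (enorm x)^-1 *: x.

Lemma measurable_enorm : measurable_fun setT enorm.
Proof.
apply: (@measurableT_comp _ _ _ _ _ _ (@Num.sqrt R)).
  by apply: continuous_measurable_fun; exact: sqrt_continuous.
by apply: measurable_sum => i; apply: measurable_funM; exact: measurable_coord.
Qed.

Lemma measurable_punctured_ball : measurable punctured_ball.
Proof.
have -> : punctured_ball = enorm @^-1` `]0, 1].
  by apply/seteqP; split => x /=; rewrite in_itv.
by rewrite -[X in measurable X]setTI; exact: measurable_enorm.
Qed.

Lemma measurable_normalize : measurable_fun setT normalize.
Proof.
apply: measurable_fun_rV => i.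
have -> : (fun x => normalize x ord0 i) =
    (fun x => (@powR R ^~ (-1) \o enorm) x * x ord0 i).
  by apply/funext => x; rewrite mxE /= powR_inv1// sqrtr_ge0.
apply: measurable_funM; last exact: measurable_coord.
by apply: measurableT_comp measurable_enorm; exact: measurable_powR.
Qed.

(* |{r w : w in A, |w| = 1, 0 < r <= 1}| *)
Definition cone_measure : set 'rV[R]_n -> \bar R :=
  pushforward (mrestr (lebesgue_rV n) measurable_punctured_ball) normalize.

Let cone_measure0 : cone_measure set0 = 0%E.
Proof. by unshelve apply: measure0; exact: measurable_normalize. Qed.

Let cone_measure_ge0 A : (0 <= cone_measure A)%E.
Proof. by unshelve apply: measure_ge0; exact: measurable_normalize. Qed.

Let cone_measure_sigma_additive : semi_sigma_additive cone_measure.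
Proof.
by unshelve apply: measure_semi_sigma_additive; exact: measurable_normalize.
Qed.

HB.instance Definition _ := isMeasure.Build _ _ _ cone_measure
  cone_measure0 cone_measure_ge0 cone_measure_sigma_additive.

(* The surface measure of the unit sphere, as a measure on R^n carried by the  *)
(* sphere. The factor n makes dy = r^(n-1) dr dsigma in polar coordinates; for *)
(* n = 1 it is the counting measure of {-1, 1}.                                *)
Definition sphere_measure : set 'rV[R]_n -> \bar R := mscale n%:R%:nng cone_measure.

HB.instance Definition _ := Measure.on sphere_measure.

End sphere.
Arguments sphere {R} n.
Arguments sphere_measure {R} n.

Section hard_spheres.
Context {R : realType} {n : nat}.
Implicit Types (x xi xs nn : 'rV[R]_n) (f g lam : 'rV[R]_n -> 'rV[R]_n -> R -> R).

Definition post_xi nn xi xs := xi - dot nn (xi - xs) *: nn.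

Definition post_xs nn xi xs := xs + dot nn (xi - xs) *: nn.

Definition Qgain f g x xi t : \bar R :=
  (2^-1%:E * \int[lebesgue_rV n]_xs \int[sphere_measure n]_(nn in sphere n)
    (let xi' := post_xi nn xi xs in
     let xs' := post_xs nn xi xs in
     (f x xi' t * g x xs' t + g x xi' t * f x xs' t)
       * `|dot nn (xi' - xs')|)%:E)%E.

Definition Qloss f g x xi t : \bar R :=
  (2^-1%:E * \int[lebesgue_rV n]_xs \int[sphere_measure n]_(nn in sphere n)
    ((f x xs t * g x xi t + g x xs t * f x xi t) * `|dot nn (xi - xs)|)%:E)%E.

(* Classical solution on [0, +oo[ : for each xi, continuous in (x, t) up to    *)
(* t = 0, differentiable in (x, t) for t > 0.                                  *)
Definition transport_solution g := forall xi,
  {within [set p : 'rV[R]_n * R | 0 <= p.2],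
    continuous (fun p => g p.1 xi p.2)} /\
  forall x (t : R), 0 < t ->
    differentiable (fun p : 'rV[R]_n * R => g p.1 xi p.2) (x, t) /\
    derive1 (g x xi) t
      + \sum_(i < n) xi ord0 i * 'D_(delta_mx ord0 i) (fun y => g y xi t) x = 0.

Definition flux_sup (Q : ('rV[R]_n -> 'rV[R]_n -> R -> R) ->
      ('rV[R]_n -> 'rV[R]_n -> R -> R) -> 'rV[R]_n -> 'rV[R]_n -> R -> \bar R)
    lam (w : 'rV[R]_n -> R) (z : R) : \bar R :=
  ereal_sup (range (fun p : 'rV[R]_n * 'rV[R]_n =>
    let: (x, xi) := p in
    ((w x / lam x xi 0)%:E *
     \int[lebesgue_measure]_(t in `[z, +oo[) Q lam lam (x + t *: xi)%R xi t)%E)).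

Definition frame_constant lam : \bar R :=
  (flux_sup Qgain lam (cst 1%R) 0%R + flux_sup Qloss lam (cst 1%R) 0%R)%E.

(* Measurability and positivity are what the integrals of Q(lam, lam) and the  *)
(* quotients by lam x xi 0 presuppose.                                         *)
Definition scattering_frame lam :=
  [/\ measurable_fun [set p : 'rV[R]_n * 'rV[R]_n * R | 0 <= p.2]
        (fun p => lam p.1.1 p.1.2 p.2),
      forall x xi, 0 < lam x xi 0,
      transport_solution lam,
      (frame_constant lam < +oo)%E &
      forall D : set 'rV[R]_n, bounded_set D ->
        (flux_sup Qgain lam \1_D z + flux_sup Qloss lam \1_D z)%E
          @[z --> +oo%R] --> 0%E].

Definition isotropic_radius lam (alpha : R) :=
  0 < 1 / (2 * alpha) /\ (1 / (2 * alpha))%:E = frame_constant lam.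

Definition gaussian x xi (t : R) : R :=
  expR (- enorm (x - t *: xi) ^+ 2 - enorm xi ^+ 2).

End hard_spheres.

Definition sphere_volume (R : realType) (n : nat) : \bar R :=
  sphere_measure n (sphere n).

Definition Omega (R : realType) (n : nat) : \bar R :=
  ereal_sup (range (fun p : 'rV[R]_n * 'rV[R]_n =>
    let: (x, xi) := p in
    (\int[lebesgue_measure]_(s in `[0%R, +oo[) \int[lebesgue_rV n]_xs
      (expR (- enorm (x + s *: xi - s *: xs) ^+ 2 - enorm xs ^+ 2)
        * enorm (xi - xs))%:E)%E)).

(* Main.v *)
(* Conservation of momentum and energy gives lam' lam'_* = lam lam_*, so the    *)
(* gain and loss terms of the Gaussian coincide; bounding |n . (xi - xi_* )| by *)
(* |xi - xi_*| makes each flux at most V_(n-1) times the double integral        *)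
(* defining Omega, whence 1 / (2 alpha) <= 2 V_(n-1) Omega. By Tonelli that     *)
(* double integral is an integral over xi_* of exp(- |xi_*|^2) times            *)
(*   int_z^oo exp(- |x + s u|^2) |u| ds <= pi / 2 - atan (z |u| - |x|),         *)
(* with u = xi - xi_*: project on the direction of u and use                    *)
(* exp(- r^2) <= 1 / (1 + r^2). This is at most pi, which makes Omega finite.   *)
(* For the tail, the velocities with |u| >= d contribute little once z d is     *)
(* large, and the others lie in a box of volume (2 d)^n; take d = z^(-1/2).     *)
Require Import Defs.
From mathcomp Require Import all_boot all_order all_algebra.
From mathcomp Require Import all_classical all_reals all_analysis.
From mathcomp Require Import measurable_realfun ring lra.

Set Implicit Arguments.
Unset Strict Implicit.
Unset Printing Implicit Defensive.

Import Order.TTheory GRing.Theory Num.Theory.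
Import numFieldNormedType.Exports.

Local Open Scope classical_set_scope.
Local Open Scope ring_scope.

(** The Gaussian depends on x only through x - t xi, so it is constant along characteristics. This
    gives the transport equation, and in [Qloss_gaussian_le] it pulls lam(x, xi, 0) out of the loss
    term, where it cancels the weight. Gain equals loss ([Qgain_gaussian]) and each flux is at most
    V Omega, so the frame constant is at most 2 V Omega ([frame_constant_gaussian_le]); 1 / (2
    alpha) <= 2 V Omega then rearranges to the bound on alpha.

    Finiteness and decay both come from [integral_gauss_ray_le]. The factor |xi - xs| is the speed
    along a line, so the time integral becomes an integral over arc length and stays bounded even
    for slow relative motion. [ray_integral_tail] makes the tail small uniformly in xi and in
    bounded x.

    For alpha to exist the frame constant must also be positive: [frame_constant_gaussian_gt0]
    bounds the loss flux below at x = xi = 0, using an explicit cube of velocities and an explicit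
    piece of the sphere ([integral_sphere_dot_ge]). *)

Section integral_mono.
Context {d} {T : measurableType d} {R : realType}.
Local Open Scope ereal_scope.

(** The integral of a nonnegative function is a supremum over the simple functions below it, hence
    monotone without measurability. This allows estimates on iterated integrals such as [Qloss]
    whose measurability in the outer variable is never established. *)
Lemma ge0_le_integral_nomeas (mu : {measure set T -> \bar R}) (D : set T)
    (f g : T -> \bar R) :
  (forall x, D x -> 0 <= f x) -> (forall x, D x -> f x <= g x) ->
  \int[mu]_(x in D) f x <= \int[mu]_(x in D) g x.
Proof.
move=> f0 fg.
have g0 x : D x -> 0 <= g x by move=> Dx; rewrite (le_trans (f0 _ Dx))// fg.
rewrite !ge0_integralE//; apply: le_ereal_sup => _ [h hf <-].
exists h => // x; rewrite (le_trans (hf x))// /patch.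
by case: ifPn => // /set_mem /fg.
Qed.

End integral_mono.

(** * Iterated integrals and cubes for Lebesgue measure on R^n *)

Section lebesgue_rV_integral.
Context {R : realType}.
Local Open Scope ereal_scope.

Lemma ge0_integral_rV0 (f : 'rV[R]_0 -> \bar R) :
  measurable_fun setT f -> (forall v, 0 <= f v) ->
  \int[lebesgue_rV 0]_v f v = f 0%R.
Proof. by move=> mf f0; rewrite integral_dirac// diracT mul1e. Qed.

Lemma ge0_integral_rVS n (f : 'rV[R]_n.+1 -> \bar R) :
  measurable_fun setT f -> (forall v, 0 <= f v) ->
  \int[lebesgue_rV n.+1]_v f v =
  \int[lebesgue_measure]_x \int[lebesgue_rV n]_v f (rV_cons (x, v)).
Proof.
move=> mf f0.
rewrite [LHS](ge0_integral_pushforward (@measurable_rV_cons R n))//.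
rewrite preimage_setT fubini_tonelli1//.
  by apply: measurableT_comp mf _; exact: measurable_rV_cons.
by move=> x /=.
Qed.

(** Induction on the dimension, peeling off the first coordinate by Tonelli. It yields both the
    volume of cubes and the Gaussian integral. *)
Lemma integral_rV_prod n (f : 'I_n -> R -> R) :
  (forall i x, 0 <= f i x)%R -> (forall i, measurable_fun setT (f i)) ->
  \int[lebesgue_rV n]_v (\prod_(i < n) f i (v ord0 i))%:E =
  \prod_(i < n) \int[lebesgue_measure]_x (f i x)%:E.
Proof.
have mprod k (g : 'I_k -> R -> R) : (forall i, measurable_fun setT (g i)) ->
    measurable_fun setT (fun v : 'rV[R]_k => \prod_(i < k) g i (v ord0 i))%R.
  move=> mg; apply: measurable_prod => i _.
  exact: measurableT_comp (mg i) (measurable_coord i).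
elim: n f => [|n IH] f f0 mf.
  rewrite ge0_integral_rV0//; first by rewrite !big_ord0.
    by apply/measurable_EFinP; exact: mprod.
  by move=> v; rewrite lee_fin prodr_ge0.
rewrite ge0_integral_rVS//; last 2 first.
- by apply/measurable_EFinP; exact: mprod.
- by move=> v; rewrite lee_fin prodr_ge0.
rewrite big_ord_recl -IH//.
under eq_integral.
  move=> x _.
  under eq_integral.
    move=> v _; rewrite big_ord_recl EFinM mxE unlift_none /=.
    under eq_bigr do rewrite mxE liftK /=.
    over.
  rewrite ge0_integralZl//; last 3 first.
  - by apply/measurable_EFinP; apply: (mprod _ (fun i => f (lift ord0 i))).
  - by move=> v _; rewrite lee_fin prodr_ge0.
  - by rewrite lee_fin.
  over.
rewrite ge0_integralZr//.
- by apply/measurable_EFinP; exact: mf.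
- by move=> x _; rewrite lee_fin.
- by apply: integral_ge0 => v _; rewrite lee_fin prodr_ge0.
Qed.

Lemma measurable_rV_box n (a : 'I_n -> R) (r : R) :
  measurable [set v : 'rV[R]_n | forall i, v ord0 i \in `]a i, (a i + r)%R[].
Proof.
rewrite (_ : mkset _ = \bigcap_(i in [set: 'I_n])
    ((fun v : 'rV[R]_n => v ord0 i) @^-1` `]a i, (a i + r)%R[%classic)).
  apply: fin_bigcap_measurable => // i _; rewrite -[X in measurable X]setTI.
  by apply: measurable_coord => //; exact: measurable_itv.
by apply/seteqP; split=> [v Bv i _|v Bv i]; exact: Bv.
Qed.

Lemma lebesgue_rV_box n (a : 'I_n -> R) (r : R) : (0 <= r)%R ->
  lebesgue_rV n [set v : 'rV[R]_n | forall i, v ord0 i \in `]a i, (a i + r)%R[] = (r ^+ n)%:E.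
Proof.
move=> r0; set B := [set v | _].
have BE : \1_B = fun v : 'rV[R]_n =>
    (\prod_(i < n) (\1_(`]a i, (a i + r)%R[%classic : set R) (v ord0 i) : R))%R.
  apply/funext => v; rewrite indicE; case: (pselect (B v)) => Bv.
    by rewrite mem_set// big1// => i _; rewrite indicE mem_set//; exact: Bv.
  rewrite memNset//; move/existsNP : Bv => [i /negP vi].
  rewrite (bigD1 i)//= indicE memNset ?mul0r//.
  by move: vi => /[swap] /= ->.
have mB : measurable B by exact: measurable_rV_box.
have := @integral_indic _ _ _ (lebesgue_rV n) _ measurableT _ mB.
rewrite setIT => <-; rewrite BE.
rewrite (@integral_rV_prod n (fun i => \1_(`]a i, (a i + r)%R[%classic : set R)))//.
rewrite (eq_bigr (fun=> r%:E)) ?prodEFin ?prodr_const ?card_ord// => i _.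
rewrite integral_indic// setIT.
have := lebesgue_measure_itv (Interval (BRight (a i)) (BLeft (a i + r)%R)).
rewrite /= lte_fin ltrDl -EFinB addrAC subrr add0r => ->.
by case: ltgtP r0 => // <-.
Qed.

End lebesgue_rV_integral.

(** * Euclidean geometry and the collision invariants *)

Section euclidean.
Context {R : realType} {n : nat}.
Implicit Types (x y z u v nn : 'rV[R]_n) (a t : R).

Lemma dotC x y : dot x y = dot y x.
Proof. by apply: eq_bigr => i _; rewrite mulrC. Qed.

Lemma dotDr x y z : dot x (y + z) = dot x y + dot x z.
Proof. by rewrite -big_split; apply: eq_bigr => i _; rewrite !mxE mulrDr. Qed.

Lemma dotDl x y z : dot (y + z) x = dot y x + dot z x.
Proof. by rewrite dotC dotDr !(dotC x). Qed.

Lemma dotZr a x y : dot x (a *: y) = a * dot x y.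
Proof. by rewrite [RHS]big_distrr; apply: eq_bigr => i _; rewrite !mxE mulrCA. Qed.

Lemma dotZl a x y : dot (a *: y) x = a * dot y x.
Proof. by rewrite dotC dotZr dotC. Qed.

Lemma dotNr x y : dot x (- y) = - dot x y.
Proof. by rewrite -scaleN1r dotZr mulN1r. Qed.

Lemma dot_ge0 x : 0 <= dot x x.
Proof. by apply: sumr_ge0 => i _; rewrite -expr2 sqr_ge0. Qed.

Lemma enorm_ge0 x : 0 <= enorm x. Proof. exact: sqrtr_ge0. Qed.

Lemma sqr_enorm x : enorm x ^+ 2 = dot x x.
Proof. by rewrite sqr_sqrtr// dot_ge0. Qed.

Lemma le_coord_enorm x i : `|x ord0 i| <= enorm x.
Proof.
rewrite -[leRHS]ger0_norm ?enorm_ge0// -ler_sqr ?nnegrE// !real_normK ?num_real//.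
rewrite sqr_enorm /dot (bigD1 i)//= -expr2 lerDl.
by apply: sumr_ge0 => j _; rewrite -expr2 sqr_ge0.
Qed.

Lemma enormZ a x : enorm (a *: x) = `|a| * enorm x.
Proof.
by rewrite /enorm dotZl dotZr mulrA -expr2 sqrtrM ?sqr_ge0// sqrtr_sqr.
Qed.

Lemma sqr_enorm_le_card x a : (forall i, `|x ord0 i| <= a) ->
  enorm x ^+ 2 <= n%:R * a ^+ 2.
Proof.
move=> xa; rewrite sqr_enorm mulr_natl -[X in a ^+ _ *+ X]card_ord -sumr_const.
apply: ler_sum => i _; rewrite -expr2 -[leLHS]real_normK ?num_real//.
by rewrite lerXn2r// nnegrE// (le_trans _ (xa i)).
Qed.

Lemma sqr_enormDunit nn x a : enorm nn = 1 ->
  enorm (x + a *: nn) ^+ 2 = enorm x ^+ 2 + 2 * a * dot nn x + a ^+ 2.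
Proof.
move=> nn1; have : dot nn nn = 1 by rewrite -sqr_enorm nn1 expr1n.
rewrite !sqr_enorm dotDl !dotDr !dotZl !dotZr => ->.
by rewrite (dotC x nn); ring.
Qed.

(** Cauchy-Schwarz for a unit vector: the difference of the two sides is the squared norm of the
    component of x orthogonal to [nn]. *)
Lemma sqr_dot_unit_le nn x : enorm nn = 1 -> dot nn x ^+ 2 <= enorm x ^+ 2.
Proof.
move=> nn1; have := sqr_ge0 (enorm (x + (- dot nn x) *: nn)).
rewrite sqr_enormDunit// => h; rewrite -subr_ge0.
by rewrite (le_trans h)// le_eqVlt; apply/orP; left; apply/eqP; ring.
Qed.

Lemma dot_unit_le nn x : enorm nn = 1 -> `|dot nn x| <= enorm x.
Proof.
move=> /sqr_dot_unit_le h.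
rewrite -ler_sqr ?nnegrE ?enorm_ge0// real_normK ?num_real//; exact: h.
Qed.

Lemma enorm_normalize x : 0 < enorm x -> enorm (normalize x) = 1.
Proof.
by move=> x0; rewrite enormZ ger0_norm ?invr_ge0 ?enorm_ge0// mulVf// gt_eqF.
Qed.

(** The projection of x + t u on the direction of u is affine in t with slope |u|, which reduces
    integrals along the line to one dimension. *)
Lemma sqr_enorm_line_ge x u t : 0 < enorm u ->
  (dot (normalize u) x + t * enorm u) ^+ 2 <= enorm (x + t *: u) ^+ 2.
Proof.
move=> u0; have := sqr_dot_unit_le (x + t *: u) (enorm_normalize u0).
rewrite dotDr dotZr.
suff -> : dot (normalize u) u = enorm u by [].
by rewrite dotZl -sqr_enorm expr2 mulKf// gt_eqF.
Qed.

(** The collision shifts the two velocities by opposite multiples of [nn], and hence y - t xi and y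
    - t xs as well. With k = nn . (xi - xs), the linear and quadratic terms of the expanded squares
    cancel. *)
Lemma gaussianM_post nn y xi xs t : enorm nn = 1 ->
  gaussian y (post_xi nn xi xs) t * gaussian y (post_xs nn xi xs) t =
  gaussian y xi t * gaussian y xs t.
Proof.
move=> nn1; rewrite /gaussian -!expRD; congr expR.
rewrite /post_xi /post_xs; set k := dot nn _.
have -> : y - t *: (xi - k *: nn) = y - t *: xi + (t * k) *: nn.
  by rewrite scalerBr scalerA opprB addrCA addrC.
have -> : y - t *: (xs + k *: nn) = y - t *: xs + (- (t * k)) *: nn.
  by rewrite scalerDr scalerA opprD addrA scaleNr.
rewrite -[- (k *: nn)]scaleNr !sqr_enormDunit//.
have kE : k = dot nn xi - dot nn xs by rewrite /k dotDr dotNr.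
by rewrite !dotDr !dotNr !dotZr kE; ring.
Qed.

Lemma dot_post nn xi xs : enorm nn = 1 ->
  dot nn (post_xi nn xi xs - post_xs nn xi xs) = - dot nn (xi - xs).
Proof.
move=> nn1; have nnnn : dot nn nn = 1 by rewrite -sqr_enorm nn1 expr1n.
by rewrite /post_xi /post_xs !(dotDr, dotNr, dotZr) nnnn; ring.
Qed.

Lemma measurable_sphere : measurable (@sphere R n).
Proof.
rewrite (_ : sphere n = @enorm R n @^-1` [set 1])//.
by rewrite -[X in measurable X]setTI; apply: measurable_enorm.
Qed.

End euclidean.

(** * Gaussian integrals along rays and over the whole space *)

Section line.
Context {R : realType}.

(** The antiderivative is atan(c + s k), which tends to pi / 2 because k > 0. *)
Lemma integral_atan_ray (c k z : R) : 0 < k ->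
  (\int[lebesgue_measure]_(s in `[z, +oo[) (k / (1 + (c + s * k) ^+ 2))%:E =
   (pi / 2 - atan (c + z * k))%:E)%E.
Proof.
move=> k0.
have D0 x : 1 + (c + x * k) ^+ 2 != 0 by rewrite gt_eqF// ltr_pwDl// sqr_ge0.
have dF (x : R) : is_derive x 1 (fun s => atan (c + s * k)) (k / (1 + (c + x * k) ^+ 2)).
  have dl : is_derive x 1 (fun s : R => c + s * k) k.
    by apply: is_derive_eq; rewrite /GRing.scale /=; ring.
  have := @is_derive1_comp _ atan (fun s : R => c + s * k) _ _ _ (is_derive1_atan _) dl.
  by rewrite mulrC.
have cF : continuous (fun s : R => atan (c + s * k)).
  move=> x; apply: differentiable_continuous; apply/derivable1_diffP.
  by case: (dF x).
rewrite (@ge0_continuous_FTC2y R _ (fun s : R => atan (c + s * k)) z (pi / 2))//.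
- by move=> x _; rewrite divr_ge0 ?(ltW k0)// addr_ge0// sqr_ge0.
- apply: continuous_subspaceT => x.
  apply: cvgM; first exact: cvg_cst.
  apply: cvgV => //; apply: cvgD; first exact: cvg_cst.
  apply: (@continuous_comp _ _ _ (fun s : R => c + s * k) (fun s : R => s ^+ 2)).
    by apply: cvgD; [exact: cvg_cst|apply: cvgM; [exact: cvg_id|exact: cvg_cst]].
  exact: exprn_continuous.
- apply: (@cvg_comp _ _ _ (fun s : R => c + s * k) atan _ +oo); last exact: cvgy_atan.
  apply/cvgryPge => A; near=> s.
  by rewrite -lerBlDl -ler_pdivrMr.
- by apply: cvg_at_right_filter; exact: cF.
- by move=> x _; rewrite derive1E; case: (dF x).
Unshelve. all: by end_near. Qed.

Lemma expRN_le_inv1D (a : R) : 0 <= a -> expR (- a) <= (1 + a)^-1.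
Proof.
move=> a0; rewrite expRN lef_pV2 ?posrE ?expR_gt0 ?ltr_pwDl//.
exact: expR_ge1Dx.
Qed.

Lemma integral_gauss_ray_le n (x u : 'rV[R]_n) (z : R) :
  (\int[lebesgue_measure]_(s in `[z, +oo[)
      (expR (- enorm (x + s *: u) ^+ 2) * enorm u)%:E <=
   (pi / 2 - atan (z * enorm u - enorm x))%:E)%E.
Proof.
have [u0|] := ltP 0 (enorm u); last first.
  rewrite le_eqVlt ltNge enorm_ge0 orbF => /eqP u0.
  rewrite integral0_eq; last by move=> s _; rewrite u0 mulr0.
  by rewrite lee_fin subr_ge0 ltW// atan_ltpi2.
set c := dot (normalize u) x.
apply: (@le_trans _ _ (pi / 2 - atan (c + z * enorm u))%:E).
  rewrite -integral_atan_ray//; apply: ge0_le_integral_nomeas => s _.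
    by rewrite lee_fin mulr_ge0 ?expR_ge0 ?enorm_ge0.
  rewrite lee_fin mulrC ler_wpM2l ?enorm_ge0//.
  apply: (le_trans (expRN_le_inv1D (sqr_ge0 _))).
  by rewrite lef_pV2 ?posrE ?ltr_pwDl ?sqr_ge0// lerD2l sqr_enorm_line_ge.
(* By Cauchy-Schwarz c >= - |x|, and atan is increasing; the bound no longer depends on the
   direction of u. *)
rewrite lee_fin lerD2l lerN2 le_atan// addrC lerD2r lerNl.
have := dot_unit_le x (enorm_normalize u0).
by rewrite -/c ler_norml lerNl => /andP[].
Qed.

Lemma integral_rV_gauss n :
  (\int[lebesgue_rV n]_v (expR (- enorm v ^+ 2))%:E = (Num.sqrt pi ^+ n)%:E :> \bar R)%E.
Proof.
have -> : (fun v : 'rV[R]_n => (expR (- enorm v ^+ 2))%:E) =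
    fun v => (\prod_(i < n) gauss_fun (v ord0 i))%:E.
  apply/funext => v; rewrite sqr_enorm -expR_sum -sumrN.
  by congr (expR _)%:E; apply: eq_bigr => i _; rewrite expr2.
rewrite (@integral_rV_prod _ _ (fun=> gauss_fun)).
- rewrite (eq_bigr (fun=> (Num.sqrt pi)%:E)) ?prodEFin ?prodr_const ?card_ord// => i _.
  exact: integralT_gauss.
- by move=> _ x; exact: gauss_fun_ge0.
- by move=> _; exact: measurable_gauss_fun.
Qed.

End line.

(** * Finiteness and positivity of the surface measure *)

Section sphere_bounds.
Context {R : realType}.

Lemma sphere_measureE n (A : set 'rV[R]_n) :
  sphere_measure n A = (n%:R%:E *
    lebesgue_rV n (@normalize R n @^-1` A `&` @punctured_ball R n))%E.
Proof. by []. Qed.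

Lemma sphere_volume_lty n : (sphere_volume R n < +oo)%E.
Proof.
rewrite /sphere_volume sphere_measureE lte_mul_pinfty ?lee_fin//.
apply: (@le_lt_trans _ _
    (lebesgue_rV n [set v | forall i, v ord0 i \in `](-2), (-2 + 4)%R[])).
  apply: le_measure; rewrite ?inE.
  - apply: measurableI; last exact: measurable_punctured_ball.
    rewrite -[X in measurable X]setTI; apply: measurable_normalize => //.
    exact: measurable_sphere.
  - exact: measurable_rV_box.
  - move=> v [_ /andP[_ v1]] i /=; have := le_trans (le_coord_enorm v i) v1.
    by rewrite in_itv/= ler_norml => /andP[? ?]; apply/andP; split; lra.
by rewrite lebesgue_rV_box// ltry.
Qed.

(** On the part [P] of the sphere with nonnegative coordinates, nn . v >= nn . nn = 1, so the
    integral is at least the measure of [P]. *)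
Lemma integral_sphere_dot_ge n : (0 < n)%N -> exists2 c : R, 0 < c &
  forall v : 'rV[R]_n, (forall i, 1 <= v ord0 i) ->
    (c%:E <= \int[sphere_measure n]_(nn in sphere n) (`|dot nn v|)%:E)%E.
Proof.
move=> n0; have n0R : 0 < n%:R :> R by rewrite ltr0n.
pose P := sphere n `&` [set nn : 'rV[R]_n | forall i, 0 <= nn ord0 i].
have mP : measurable P.
  apply: measurableI; first exact: measurable_sphere.
  rewrite (_ : [set _ | _] = \bigcap_(i in [set: 'I_n])
      ((fun v : 'rV[R]_n => v ord0 i) @^-1` `[0, +oo[%classic)).
    apply: fin_bigcap_measurable => // i _; rewrite -[X in measurable X]setTI.
    by apply: measurable_coord => //; exact: measurable_itv.
  apply/seteqP; split=> v /= vP i; first by move=> _; rewrite /= in_itv/= andbT.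
  by have := vP i I; rewrite /= in_itv/= andbT.
(* The cone over [P] contains the open cube of side 1/n at the origin: its points satisfy |w|^2 <= n
   (1/n)^2 <= 1. The leading n is the normalisation of [sphere_measure]. *)
exists (n%:R * n%:R^-1 ^+ n); first by rewrite mulr_gt0// exprn_gt0// invr_gt0.
move=> v v1; apply: (@le_trans _ _ (sphere_measure n P)).
  rewrite sphere_measureE EFinM lee_pmul2l//.
  rewrite -(@lebesgue_rV_box _ _ (fun=> 0)) ?invr_ge0//.
  apply: le_measure; rewrite ?inE.
  - exact: measurable_rV_box.
  - apply: measurableI; last exact: measurable_punctured_ball.
    by rewrite -[X in measurable X]setTI; apply: measurable_normalize.
  - move=> w w0 /=.
    have w0' i : 0 < w ord0 i by have := w0 i; rewrite in_itv/= => /andP[].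
    have wn i : `|w ord0 i| <= n%:R^-1.
      have := w0 i; rewrite in_itv/= add0r => /andP[_ /ltW].
      by rewrite ger0_norm// ltW.
    have e0 : 0 < enorm w.
      by apply: lt_le_trans (le_coord_enorm w (Ordinal n0)); rewrite normr_gt0 gt_eqF.
    split; last first.
      apply/andP; split => //.
      rewrite -[leRHS]ger0_norm// -[leLHS]ger0_norm ?enorm_ge0//.
      rewrite -ler_sqr ?nnegrE// !real_normK ?num_real// expr1n.
      rewrite (le_trans (sqr_enorm_le_card wn))// expr2 mulrA divff ?gt_eqF// mul1r.
      by rewrite invf_le1// ler1n.
    split; first exact: enorm_normalize.
    by move=> i; rewrite mxE mulr_ge0 ?invr_ge0 ?enorm_ge0// ltW.
have PS : P `&` sphere n = P by rewrite setIC; apply: setIidr => nn [].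
rewrite -{1}PS -integral_indic//; last exact: measurable_sphere.
apply: ge0_le_integral_nomeas => nn nn1; first by rewrite lee_fin.
rewrite lee_fin indicE; case: (boolP (nn \in P)) => [/set_mem [_ nn0]|_]; last exact: normr_ge0.
apply: le_trans (ler_norm _).
have <- : dot nn nn = 1 by rewrite -sqr_enorm nn1 expr1n.
(* Termwise: a coordinate of a unit vector is at most 1, and 1 <= [v ord0 i]. *)
apply: ler_sum => i _; rewrite ler_wpM2l//; apply: le_trans (v1 i).
by have := le_coord_enorm nn i; rewrite nn1 ler_norml => /andP[].
Qed.

End sphere_bounds.

(** * The double integral behind [Omega], and its tails *)

Section ray_integral.
Context {R : realType} {n : nat}.
Implicit Types (x xi xs : 'rV[R]_n) (s t z : R).

Definition ray_kernel x xi s xs : R :=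
  expR (- enorm (x + s *: xi - s *: xs) ^+ 2 - enorm xs ^+ 2) * enorm (xi - xs).

(** At z = 0 this is the quantity whose supremum is [Omega]; large z controls the tail condition of
    a scattering frame. *)
Definition ray_integral x xi z : \bar R :=
  (\int[lebesgue_measure]_(s in `[z, +oo[) \int[lebesgue_rV n]_xs
     (ray_kernel x xi s xs)%:E)%E.

Lemma ray_kernel_ge0 x xi s xs : 0 <= ray_kernel x xi s xs.
Proof. by rewrite mulr_ge0 ?expR_ge0 ?enorm_ge0. Qed.

Lemma ray_integral_ge0 x xi z : (0 <= ray_integral x xi z)%E.
Proof.
apply: integral_ge0 => s _; apply: integral_ge0 => xs _.
by rewrite lee_fin ray_kernel_ge0.
Qed.

Lemma ray_kernelE x xi s xs : ray_kernel x xi s xs =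
  expR (- enorm xs ^+ 2) *
  (expR (- enorm (x + s *: (xi - xs)) ^+ 2) * enorm (xi - xs)).
Proof. by rewrite /ray_kernel scalerBr addrA expRD mulrAC mulrC mulrA. Qed.

Lemma measurable_ray_kernel x xi :
  measurable_fun setT (fun p : measurableTypeR R * 'rV[R]_n => ray_kernel x xi p.1 p.2).
Proof.
have mcoord i : measurable_fun setT
    (fun p : measurableTypeR R * 'rV[R]_n => p.2 ord0 i).
  exact: measurableT_comp (measurable_coord i) measurable_snd.
have menorm (f : measurableTypeR R * 'rV[R]_n -> 'rV[R]_n) : (forall i, measurable_fun setT
    (fun p : measurableTypeR R * 'rV[R]_n => f p ord0 i)) ->
    measurable_fun setT (fun p => @enorm R n (f p)).
  by move=> mf; apply: measurableT_comp (@measurable_enorm _ _) _; exact: measurable_fun_rV.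
apply: measurable_funM; last first.
  apply: menorm => i; under eq_fun do rewrite !mxE.
  by apply: measurable_funB; [exact: measurable_cst|exact: mcoord].
apply: measurableT_comp; first exact: measurable_expR.
apply: measurable_funB; last by apply: measurable_funX; exact: menorm.
apply: measurableT_comp; first exact: oppr_measurable.
apply: measurable_funX; apply: menorm => i; under eq_fun do rewrite !mxE.
apply: measurable_funB; last by apply: measurable_funM => //; exact: measurable_fst.
apply: measurable_funD; first exact: measurable_cst.
by apply: measurable_funM; [exact: measurable_fst|exact: measurable_cst].
Qed.

(* Tonelli: for fixed xs the integral over s runs along a straight line. *)
Lemma ray_integral_le x xi z : (ray_integral x xi z <=
  \int[lebesgue_rV n]_xs
    (expR (- enorm xs ^+ 2) *
      (pi / 2 - atan (z * enorm (xi - xs) - enorm x)))%:E)%E.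
Proof.
set D := `[z, +oo[%classic : set (measurableTypeR R).
have mD : measurable D by exact: measurable_itv.
pose f (p : measurableTypeR R * 'rV[R]_n) : \bar R :=
  (ray_kernel x xi p.1 p.2 * \1_D p.1)%:E.
have f0 p : (0 <= f p)%E by rewrite lee_fin mulr_ge0 ?ray_kernel_ge0.
have mf : measurable_fun setT f.
  apply/measurable_EFinP/measurable_funM; first exact: measurable_ray_kernel.
  by apply: measurableT_comp measurable_fst; exact: measurable_indic.
have -> : ray_integral x xi z =
    (\int[lebesgue_measure]_s \int[lebesgue_rV n]_xs f (s, xs))%E.
  rewrite /ray_integral integral_mkcond; apply: eq_integral => s _.
  rewrite patchE /f /= indicE; case: ifPn => sD.
    by under [RHS]eq_integral do rewrite mulr1.
  by under [RHS]eq_integral do rewrite mulr0; rewrite integral0.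
rewrite fubini_tonelli//.
apply: ge0_le_integral_nomeas => xs _; first exact: integral_ge0.
apply: (@le_trans _ _ (\int[lebesgue_measure]_(s in D) (ray_kernel x xi s xs)%:E)%E).
  rewrite [leRHS]integral_mkcond; apply: ge0_le_integral_nomeas => // s _.
  by rewrite patchE /f /= indicE; case: ifPn => sD; rewrite (mulr1,mulr0).
under eq_integral do rewrite ray_kernelE EFinM.
rewrite ge0_integralZl_EFin ?expR_ge0//; last 2 first.
- by move=> s _; rewrite lee_fin mulr_ge0 ?expR_ge0 ?enorm_ge0.
- apply/measurable_EFinP/measurable_funTS.
  (* Restoring the constant factor exp(- |xs|^2) turns the integrand into a section of the jointly
     measurable kernel. *)
  rewrite (_ : (fun s => _) = (fun s => expR (enorm xs ^+ 2) * ray_kernel x xi s xs)).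
    apply: measurable_funM; first exact: measurable_cst.
    exact: measurableT_comp (measurable_ray_kernel x xi) (measurable_pair2 xs).
  by apply/funext => s; rewrite ray_kernelE mulrA -expRD subrr expR0 mul1r.
rewrite EFinM lee_pmul2l// ?lte_fin ?expR_gt0//.
exact: integral_gauss_ray_le.
Qed.

Let G : R := Num.sqrt pi ^+ n.

Lemma measurable_gauss : measurable_fun setT (fun v : 'rV[R]_n => expR (- enorm v ^+ 2)).
Proof.
apply: measurableT_comp; first exact: measurable_expR.
apply: measurableT_comp; first exact: oppr_measurable.
by apply: measurable_funX; exact: measurable_enorm.
Qed.

(** Since atan > - pi / 2, the time integral costs at most pi for every velocity, and the Gaussian
    weight integrates to [G]. Hence [Omega] is finite. *)
Lemma ray_integral_le_cst x xi z : (ray_integral x xi z <= (pi * G)%:E)%E.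
Proof.
apply: (le_trans (ray_integral_le x xi z)).
apply: (@le_trans _ _ (\int[lebesgue_rV n]_xs (pi%:E * (expR (- enorm xs ^+ 2))%:E))%E).
  apply: ge0_le_integral_nomeas => xs _; set a := atan _.
    by rewrite lee_fin mulr_ge0 ?expR_ge0// subr_ge0 ltW// atan_ltpi2.
  rewrite lee_fin mulrC ler_wpM2r ?expR_ge0//.
  by have := atan_gtNpi2 (z * enorm (xi - xs) - enorm x); rewrite -/a; lra.
rewrite ge0_integralZl_EFin ?pi_ge0//.
- by rewrite integral_rV_gauss.
- by apply/measurable_EFinP; exact: measurable_gauss.
Qed.

(* Splits off the velocities xs close to xi, for which the ray moves slowly. *)
Lemma ray_integral_tail x xi z (M d : R) : 0 <= z -> 0 <= d -> enorm x <= M ->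
  (ray_integral x xi z <=
    (pi * (2 * d) ^+ n + (pi / 2 - atan (z * d - M)) * G)%:E)%E.
Proof.
move=> z0 d0 xM; apply: (le_trans (ray_integral_le x xi z)).
set B := [set v : 'rV[R]_n | forall i,
  v ord0 i \in `](xi ord0 i - d), ((xi ord0 i - d) + 2 * d)%R[].
have mB : measurable B by exact: (measurable_rV_box (fun i => xi ord0 i - d)).
set b := pi / 2 - _.
have b0 : 0 <= b by rewrite subr_ge0 ltW// atan_ltpi2.
apply: (@le_trans _ _ (\int[lebesgue_rV n]_xs
    (pi%:E * (\1_B xs)%:E + b%:E * (expR (- enorm xs ^+ 2))%:E))%E).
  apply: ge0_le_integral_nomeas => xs _; set a := atan _.
    by rewrite lee_fin mulr_ge0 ?expR_ge0// subr_ge0 ltW// atan_ltpi2.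
  have := atan_gtNpi2 (z * enorm (xi - xs) - enorm x); rewrite -/a => api.
  have := atan_ltpi2 (z * enorm (xi - xs) - enorm x); rewrite -/a => api'.
  rewrite lee_fin indicE; case: (pselect (B xs)) => Bxs.
    (* In the cube the crude bounds suffice: 1 for the Gaussian, pi for the difference. *)
    rewrite mem_set// mulr1 -[leLHS]addr0 lerD ?mulr_ge0 ?expR_ge0//.
    have e1 : expR (- enorm xs ^+ 2) <= 1 by rewrite expR_le1 oppr_le0 sqr_ge0.
    apply: le_trans (_ : 1 * (pi / 2 - a) <= _); last by lra.
    by rewrite ler_wpM2r//; lra.
  rewrite memNset// mulr0 add0r mulrC ler_wpM2r ?expR_ge0//.
  rewrite lerD2l lerN2 le_atan// lerB// ler_wpM2l//.
  (* Outside the cube some coordinate of xi - xs has size at least d, so |xi - xs| >= d. *)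
  move/existsNP : Bxs => [i /negP]; rewrite in_itv/= => Bi.
  apply: le_trans (le_coord_enorm _ i); rewrite !mxE leNgt.
  apply: contra Bi; rewrite ltr_norml => /andP[? ?].
  by apply/andP; split; lra.
rewrite ge0_integralD//; last 4 first.
- by move=> v _; rewrite mule_ge0// lee_fin pi_ge0.
- by apply: measurable_funeM; exact/measurable_EFinP/measurable_indic.
- by move=> v _; rewrite mule_ge0// lee_fin expR_ge0.
- by apply: measurable_funeM; by apply/measurable_EFinP; exact: measurable_gauss.
rewrite ge0_integralZl_EFin ?pi_ge0//; last exact/measurable_EFinP/measurable_indic.
rewrite ge0_integralZl_EFin//; last first.
  by apply/measurable_EFinP; exact: measurable_gauss.
rewrite integral_rV_gauss integral_indic// setIT.
rewrite [X in (_ * X + _)%E](_ : _ = ((2 * d) ^+ n)%:E)//.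
by apply: (lebesgue_rV_box (fun i => xi ord0 i - d)); rewrite mulr_ge0.
Qed.

End ray_integral.

(** * The Gaussian solves the transport equation *)

Section gaussian_transport.
Context {R : realType} {n : nat}.
Implicit Types (x xi v : 'rV[R]_n) (t : R).

(** On a line in t or in one coordinate of x, the Gaussian is the exponential of a quadratic
    polynomial; both kinds of derivative come from this formula. *)
Lemma is_derive_expR_quad (a b c t : R) :
  is_derive t 1 (fun h : R => expR (a + b * h + c * h ^+ 2))
    (expR (a + b * t + c * t ^+ 2) * (b + 2 * c * t)).
Proof.
have dq : is_derive t 1 (fun h : R => a + b * h + c * h ^+ 2) (b + 2 * c * t).
  by apply: is_derive_eq; rewrite /GRing.scale /=; ring.
exact: (@is_derive1_comp _ expR (fun h : R => a + b * h + c * h ^+ 2) _ _ _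
  (is_derive_expR _) dq).
Qed.

Lemma derive_line (f : 'rV[R]_n -> R) x v :
  'D_v f x = derive1 (fun h : R => f (h *: v + x)) 0.
Proof.
by rewrite /derive /derive1; under [in RHS]eq_fun do rewrite addr0 scale0r add0r.
Qed.

Lemma enorm_delta i : enorm (delta_mx ord0 i : 'rV[R]_n) = 1.
Proof.
rewrite /enorm /dot (bigD1 i)//= big1 ?addr0 ?mxE ?eqxx ?mulr1 ?sqrtr1// => j ji.
by rewrite mxE (negPf ji) andbF mul0r.
Qed.

Lemma dot_delta i x : dot (delta_mx ord0 i) x = x ord0 i.
Proof.
rewrite /dot (bigD1 i)//= big1 ?addr0 ?mxE ?eqxx ?mul1r// => j ji.
by rewrite mxE (negPf ji) andbF mul0r.
Qed.

Lemma derive1_gaussian x xi t : derive1 (gaussian x xi) t =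
  gaussian x xi t * (2 * dot xi (x - t *: xi)).
Proof.
have -> : gaussian x xi = fun s : R =>
    expR ((- dot x x - dot xi xi) + 2 * dot xi x * s + (- dot xi xi) * s ^+ 2).
  apply/funext => s; rewrite /gaussian !sqr_enorm; congr expR.
  by rewrite !(dotDr, dotDl) -scaleNr !(dotZr, dotZl) (dotC x xi); ring.
rewrite derive1E; case: (is_derive_expR_quad (- dot x x - dot xi xi)
  (2 * dot xi x) (- dot xi xi) t) => _ ->.
by congr (_ * _); rewrite dotDr dotNr dotZr; ring.
Qed.

Lemma partial_gaussian x xi t i :
  'D_(delta_mx ord0 i) (fun y => gaussian y xi t) x =
  - (gaussian x xi t * (2 * (x - t *: xi) ord0 i)).
Proof.
rewrite derive_line.
pose y := x - t *: xi.
rewrite (_ : (fun h : R => gaussian (h *: delta_mx ord0 i + x) xi t) = fun h : R =>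
    expR ((- enorm y ^+ 2 - enorm xi ^+ 2) + (- (2 * y ord0 i)) * h + (-1) * h ^+ 2)).
  rewrite derive1E; case: (is_derive_expR_quad (- enorm y ^+ 2 - enorm xi ^+ 2)
    (- (2 * y ord0 i)) (-1) 0) => _ ->.
  by rewrite /gaussian -/y expr0n /= !mulr0 !addr0 mulrN.
apply/funext => h; congr expR.
rewrite -addrA addrC -/y sqr_enormDunit ?enorm_delta// dot_delta; ring.
Qed.

Lemma differentiable_gaussian xi (p : 'rV[R]_n * R) :
  differentiable (fun p : 'rV[R]_n * R => gaussian p.1 xi p.2) p.
Proof.
rewrite /gaussian.
apply: (@differentiable_comp _ _ _ _
  (fun p : 'rV[R]_n * R => - enorm (p.1 - p.2 *: xi) ^+ 2 - enorm xi ^+ 2) expR); last first.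
  by apply/derivable1_diffP; exact: derivable_expR.
apply: differentiableB; last exact: differentiable_cst.
apply: differentiableN.
(* [enorm] is a square root and not differentiable at 0; its square is a polynomial in the
   coordinates. *)
rewrite (_ : (fun p : 'rV[R]_n * R => _) = \sum_(i < n)
   (fun p : 'rV[R]_n * R => (p.1 ord0 i - p.2 * xi ord0 i) * (p.1 ord0 i - p.2 * xi ord0 i))); last first.
  apply/funext => q; rewrite sqr_enorm fct_sumE.
  by apply: eq_bigr => i _; rewrite !mxE.
apply: differentiable_sum => i.
suff d : differentiable (fun p : 'rV[R]_n * R => p.1 ord0 i - p.2 * xi ord0 i) p.
  exact: differentiableM.
apply: differentiableB.
  apply: (@differentiable_comp _ _ _ _ fst (fun v : 'rV[R]_n => v ord0 i)).
    by apply: linear_differentiable => q; exact: cvg_fst.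
  exact: differentiable_coord.
apply: differentiableM; last exact: differentiable_cst.
by apply: linear_differentiable => q; exact: cvg_snd.
Qed.

Lemma gaussian_transport_solution : transport_solution (@gaussian R n).
Proof.
move=> xi; split.
  apply: continuous_subspaceT => p.
  by apply: differentiable_continuous; exact: differentiable_gaussian.
move=> x t _; split; first exact: differentiable_gaussian.
rewrite derive1_gaussian /dot !big_distrr -big_split big1// => i _ /=.
by rewrite partial_gaussian; ring.
Qed.

Lemma measurable_gaussian :
  measurable_fun [set: 'rV[R]_n * 'rV[R]_n * R]
    (fun p => gaussian p.1.1 p.1.2 p.2).
Proof.
have mcoord i : measurable_fun setT (fun p : 'rV[R]_n * 'rV[R]_n * R => p.1.2 ord0 i).
  apply: (measurableT_comp (measurable_coord i) (g := fun p : 'rV[R]_n * 'rV[R]_n * R => p.1.2)).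
  exact: measurableT_comp measurable_snd measurable_fst.
apply: measurableT_comp; first exact: measurable_expR.
apply: measurable_funB; last first.
  apply: measurable_funX; apply: measurableT_comp; first exact: measurable_enorm.
  exact: measurable_fun_rV.
apply: measurableT_comp; first exact: oppr_measurable.
apply: measurable_funX; apply: measurableT_comp; first exact: measurable_enorm.
apply: measurable_fun_rV => i; under eq_fun do rewrite !mxE.
apply: measurable_funB; last by apply: measurable_funM; [exact: measurable_snd|exact: mcoord].
apply: (measurableT_comp (measurable_coord i) (g := fun p : 'rV[R]_n * 'rV[R]_n * R => p.1.1)).
exact: measurableT_comp measurable_fst measurable_fst.
Qed.

End gaussian_transport.

(** * Bounds on the fluxes of the Gaussian and the frame constant *)

Section gaussian_flux.
Context {R : realType} {n : nat}.
Implicit Types (x xi xs y : 'rV[R]_n) (w : 'rV[R]_n -> R) (t z : R).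

Let V : R := fine (sphere_volume R n).

Lemma sphere_volumeE : sphere_volume R n = V%:E.
Proof. by rewrite fineK// ge0_fin_numE ?sphere_volume_lty. Qed.

Lemma fine_sphere_volume_ge0 : 0 <= V.
Proof. by rewrite fine_ge0. Qed.

Lemma gaussian_gt0 x xi t : 0 < gaussian x xi t.
Proof. exact: expR_gt0. Qed.

Lemma gaussian0 xi t :
  gaussian 0 xi t = expR (- (t ^+ 2 * enorm xi ^+ 2) - enorm xi ^+ 2).
Proof.
rewrite /gaussian sub0r -[- (t *: xi)]scaleNr enormZ normrN exprMn.
by rewrite -[`|t| ^+ 2]normrX ger0_norm ?sqr_ge0.
Qed.

Lemma enorm0 : enorm (0 : 'rV[R]_n) = 0.
Proof. by rewrite -(scale0r 0) enormZ normr0 mul0r. Qed.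

(** For unit [nn] a collision preserves the product of the two Gaussians and only flips the sign of
    nn . (xi - xs), so the integrands agree pointwise. *)
Lemma Qgain_gaussian y xi t :
  Qgain (@gaussian R n) (@gaussian R n) y xi t = Qloss (@gaussian R n) (@gaussian R n) y xi t.
Proof.
rewrite /Qgain /Qloss; apply: (congr1 (fun I => 2^-1%:E * I)%E).
apply: eq_integral => xs _; apply: eq_integral => nn /set_mem nn1.
by rewrite /= dot_post// normrN gaussianM_post// (mulrC (gaussian y xi t)).
Qed.

Lemma flux_sup_gain_gaussian w z :
  flux_sup Qgain (@gaussian R n) w z = flux_sup Qloss (@gaussian R n) w z.
Proof.
rewrite /flux_sup.
apply: (congr1 (fun f : 'rV[R]_n * 'rV[R]_n -> \bar R => ereal_sup (range f))).
apply/funext => -[x xi]; apply: (congr1 (fun I => _ * I)%E).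
by apply: eq_integral => t _; exact: Qgain_gaussian.
Qed.

Lemma flux_sup_addE w z :
  (flux_sup Qgain (@gaussian R n) w z + flux_sup Qloss (@gaussian R n) w z =
   flux_sup Qloss (@gaussian R n) w z + flux_sup Qloss (@gaussian R n) w z)%E.
Proof.
apply: (congr1 (fun I => I + flux_sup Qloss (@gaussian R n) w z)%E).
exact: flux_sup_gain_gaussian.
Qed.

Lemma Qloss_gaussianE y xi t : Qloss (@gaussian R n) (@gaussian R n) y xi t =
  (2^-1%:E * \int[lebesgue_rV n]_xs \int[sphere_measure n]_(nn in sphere n)
    (2 * (gaussian y xs t * gaussian y xi t) * `|dot nn (xi - xs)|)%:E)%E.
Proof.
rewrite /Qloss; apply: (congr1 (fun I => 2^-1%:E * I)%E).
apply: eq_integral => xs _; apply: eq_integral => nn _.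
by apply: (congr1 EFin); ring.
Qed.

Lemma Qloss_gaussian_ge0 y xi t : (0 <= Qloss (@gaussian R n) (@gaussian R n) y xi t)%E.
Proof.
rewrite Qloss_gaussianE mule_ge0//; apply: integral_ge0 => xs _.
by apply: integral_ge0 => nn _; rewrite lee_fin !mulr_ge0// ltW// gaussian_gt0.
Qed.

Lemma measurable_ray_kernel2 x xi t :
  measurable_fun setT (fun xs => ray_kernel x xi t xs).
Proof.
exact: measurableT_comp (measurable_ray_kernel x xi) (measurable_pair1 t).
Qed.

(** At x + t xi the factor with velocity xi is its initial value, and the factor with velocity xs is
    the exponential in [ray_kernel]. Bounding |nn . (xi - xs)| by |xi - xs| leaves an integrand
    constant on the sphere, whence V. *)
Lemma Qloss_gaussian_le x xi t :
  (Qloss (@gaussian R n) (@gaussian R n) (x + t *: xi)%R xi t <=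
   (gaussian x xi 0 * V)%:E * \int[lebesgue_rV n]_xs (ray_kernel x xi t xs)%:E)%E.
Proof.
have gV0 : 0 <= gaussian x xi 0 * V.
  by rewrite mulr_ge0 ?fine_sphere_volume_ge0// ltW// gaussian_gt0.
rewrite Qloss_gaussianE; apply: (@le_trans _ _ (2^-1%:E * \int[lebesgue_rV n]_xs
    ((2 * (gaussian x xi 0 * V))%:E * (ray_kernel x xi t xs)%:E))%E); last first.
  have k0 : 0 <= 2 * (gaussian x xi 0 * V) by rewrite mulr_ge0.
  rewrite ge0_integralZl_EFin//.
  - by rewrite muleA -EFinM mulKf.
  - by move=> xs _; rewrite lee_fin ray_kernel_ge0.
  - by apply/measurable_EFinP; exact: measurable_ray_kernel2.
rewrite lee_pmul2l ?lte_fin ?invr_gt0//.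
apply: ge0_le_integral_nomeas => xs _.
  by apply: integral_ge0 => nn _; rewrite lee_fin !mulr_ge0// ltW// gaussian_gt0.
set a := 2 * _.
have a0 : 0 <= a by rewrite !mulr_ge0// ltW// gaussian_gt0.
have aE : a = 2 * (gaussian x xi 0 *
    expR (- enorm (x + t *: xi - t *: xs) ^+ 2 - enorm xs ^+ 2)).
  by rewrite /a /gaussian -!expRD scale0r subr0 addrK; congr (2 * expR _); ring.
apply: (@le_trans _ _ (\int[sphere_measure n]_(nn in sphere n) (cst (a * enorm (xi - xs))%:E nn))%E).
  apply: ge0_le_integral_nomeas => nn nn1; first by rewrite lee_fin mulr_ge0.
  by rewrite lee_fin ler_wpM2l// dot_unit_le.
rewrite integral_cst; last exact: measurable_sphere.
rewrite [X in (_ * X)%E](_ : _ = V%:E); last exact: sphere_volumeE.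
rewrite -!EFinM lee_fin aE /ray_kernel.
by rewrite le_eqVlt; apply/orP; left; apply/eqP; ring.
Qed.

Lemma flux_gaussian_le w x xi z : (forall y, 0 <= w y) ->
  ((w x / gaussian x xi 0)%:E * \int[lebesgue_measure]_(t in `[z, +oo[)
     Qloss (@gaussian R n) (@gaussian R n) (x + t *: xi)%R xi t <=
   V%:E * ((w x)%:E * ray_integral x xi z))%E.
Proof.
move=> w0; have g0 := gaussian_gt0 x xi 0.
have V0 := fine_sphere_volume_ge0.
rewrite (_ : V%:E * _ = (w x / gaussian x xi 0)%:E *
    ((gaussian x xi 0 * V)%:E * ray_integral x xi z))%E; last first.
  rewrite !muleA -!EFinM; congr (_%:E * _)%E.
  by rewrite mulrA mulfVK ?gt_eqF// mulrC.
apply: lee_wpmul2l; first by rewrite lee_fin divr_ge0// ltW.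
have gV0 : 0 <= gaussian x xi 0 * V by rewrite mulr_ge0// ltW.
pose h s := (\int[lebesgue_rV n]_xs (ray_kernel x xi s xs)%:E)%E.
have h0 s : (0 <= h s)%E by apply: integral_ge0 => xs _; rewrite lee_fin ray_kernel_ge0.
(* Only the majorant needs to be measurable: a constant is pulled out of its integral. *)
have mh : measurable_fun (`[z, +oo[%classic : set (measurableTypeR R)) h.
  apply: measurable_funTS.
  apply: (@measurable_fun_fubini_tonelli_F _ _ _ _ R (lebesgue_rV n)
    (fun p => (ray_kernel x xi p.1 p.2)%:E)).
    by apply/measurable_EFinP; exact: measurable_ray_kernel.
  by move=> p; rewrite lee_fin ray_kernel_ge0.
have <- := @ge0_integralZl_EFin _ _ R lebesgue_measure _ (measurable_itv _) h
  (fun s _ => h0 s) mh _ gV0.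
apply: ge0_le_integral_nomeas => t _; first exact: Qloss_gaussian_ge0.
exact: Qloss_gaussian_le.
Qed.

Lemma flux_sup_gaussian_le w z (B : R) : (forall y, 0 <= w y) ->
  (forall x xi, (w x)%:E * ray_integral x xi z <= B%:E)%E ->
  (flux_sup Qloss (@gaussian R n) w z <= (V * B)%:E)%E.
Proof.
move=> w0 wB; apply: ge_ereal_sup => _ [[x xi] _ <-].
rewrite (le_trans (flux_gaussian_le _ _ _ w0))// EFinM.
by rewrite lee_wpmul2l// lee_fin fine_sphere_volume_ge0.
Qed.

Lemma flux_sup_gaussian_ge0 w z : (forall y, 0 <= w y) ->
  (0 <= flux_sup Qloss (@gaussian R n) w z)%E.
Proof.
move=> w0; apply: le_trans (ereal_sup_ubound _); last by exists (0, 0).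
rewrite mule_ge0// ?lee_fin ?divr_ge0//; first by rewrite ltW// gaussian_gt0.
by apply: integral_ge0 => t _; exact: Qloss_gaussian_ge0.
Qed.

Lemma OmegaE : Omega R n =
  ereal_sup (range (fun p : 'rV[R]_n * 'rV[R]_n => ray_integral p.1 p.2 0)).
Proof.
apply: (congr1 (fun f : 'rV[R]_n * 'rV[R]_n -> \bar R => ereal_sup (range f))).
by apply/funext => -[x xi].
Qed.

Lemma Omega_lty : (Omega R n < +oo)%E.
Proof.
rewrite OmegaE; apply: le_lt_trans (ltry (pi * Num.sqrt pi ^+ n)).
by apply: ge_ereal_sup => _ [[x xi] _ <-]; exact: ray_integral_le_cst.
Qed.

Lemma Omega_ge0 : (0 <= Omega R n)%E.
Proof.
rewrite OmegaE; apply: le_trans (ereal_sup_ubound _); last by exists (0, 0).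
exact: ray_integral_ge0.
Qed.

Lemma frame_constant_gaussian_le :
  (frame_constant (@gaussian R n) <= (2 * (V * fine (Omega R n)))%:E)%E.
Proof.
have h : (flux_sup Qloss (@gaussian R n) (cst 1%R) 0 <= (V * fine (Omega R n))%:E)%E.
  apply: flux_sup_gaussian_le => // x xi; rewrite mul1e fineK.
    by rewrite OmegaE; apply: ereal_sup_ubound; exists (x, xi).
  by rewrite ge0_fin_numE ?Omega_lty ?Omega_ge0.
by rewrite /frame_constant flux_sup_addE mulr2n mulrDl mul1r EFinD leeD.
Qed.

(** The loss flux is tested at x = xi = 0, keeping only times in [0, 1] and velocities xs with all
    coordinates between 1 and 2, a cube of volume 1. *)
Lemma frame_constant_gaussian_gt0 : (0 < n)%N -> (0 < frame_constant (@gaussian R n))%E.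
Proof.
move=> n0; suff h : (0 < flux_sup Qloss (@gaussian R n) (cst 1%R) 0)%E.
  by rewrite /frame_constant flux_sup_addE adde_gt0.
have [c c0 hc] := @integral_sphere_dot_ge R n n0.
(* On that cube |xs|^2 <= 4 n, and t <= 1, so the exponent - t^2 |xs|^2 - |xs|^2 is at least - 8
   n. *)
set e := expR (- (n%:R * 2 ^+ 2) - (n%:R * 2 ^+ 2)) : R.
have e0 : 0 < e by exact: expR_gt0.
apply: (@lt_le_trans _ _ (e * c)%:E); first by rewrite lte_fin mulr_gt0.
apply: le_trans (ereal_sup_ubound _); last by exists (0, 0).
rewrite [X in (X * _)%E](_ : _ = 1%E); last first.
  by rewrite gaussian0 enorm0 expr0n/= mulr0 !oppr0 addr0 expR0 divr1.
rewrite mul1e.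
set B := [set v : 'rV[R]_n | forall i, v ord0 i \in `](1 : R), (1 + 1)%R[].
have mB : measurable B by exact: (@measurable_rV_box R n (fun=> 1)).
have Qge t : 0 <= t <= 1 ->
    ((e * c)%:E <= Qloss (@gaussian R n) (@gaussian R n) (0 + t *: 0)%R 0 t)%E.
  move=> /andP[t0 t1]; rewrite scaler0 addr0 Qloss_gaussianE.
  apply: (@le_trans _ _ (2^-1%:E *
      \int[lebesgue_rV n]_xs ((2 * (e * c))%:E * (\1_B xs)%:E))%E).
    rewrite ge0_integralZl_EFin//; last 2 first.
    - by apply/measurable_EFinP; exact: measurable_indic.
    - by rewrite !mulr_ge0// ltW.
    rewrite integral_indic// setIT [X in (_ * (_ * X))%E](_ : _ = (1 ^+ n)%:E); last first.
      exact: (@lebesgue_rV_box R n (fun=> 1) 1).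
    by rewrite expr1n mule1 -EFinM mulKf.
  rewrite lee_pmul2l ?lte_fin ?invr_gt0//.
  apply: ge0_le_integral_nomeas => xs _.
    by rewrite mule_ge0 ?lee_fin// !mulr_ge0// ltW.
  rewrite indicE; case: (pselect (B xs)) => Bxs; last first.
    rewrite memNset// mule0; apply: integral_ge0 => nn _.
    by rewrite lee_fin !mulr_ge0// ltW// gaussian_gt0.
  rewrite mem_set// mule1.
  under eq_integral do rewrite EFinM.
  rewrite ge0_integralZl_EFin//; last 3 first.
  - exact: measurable_sphere.
  - apply/measurable_EFinP; apply: measurable_funTS.
    apply: measurableT_comp; first exact: normr_measurable.
    apply: measurable_sum => i; apply: measurable_funM; last exact: measurable_cst.
    exact: measurable_coord.
  - by rewrite !mulr_ge0// ltW// gaussian_gt0.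
  have xs1 i : 1 <= xs ord0 i <= 2.
    by have := Bxs i; rewrite in_itv/= => /andP[? ?]; apply/andP; split; lra.
  have xsn : enorm xs ^+ 2 <= n%:R * 2 ^+ 2.
    apply: sqr_enorm_le_card => i; have /andP[? ?] := xs1 i.
    by rewrite ger0_norm//; lra.
  rewrite mulrA EFinM; apply: lee_pmul.
  - by rewrite lee_fin mulr_ge0// ltW.
  - by rewrite lee_fin ltW.
  - rewrite lee_fin ler_wpM2l// !gaussian0 -expRD ler_expR enorm0.
    have : t ^+ 2 * enorm xs ^+ 2 <= enorm xs ^+ 2.
      by rewrite ler_piMl ?sqr_ge0// expr_le1.
    by rewrite expr0n/=; lra.
  - apply: (@le_trans _ _ (\int[sphere_measure n]_(nn in sphere n) (`|dot nn xs|)%:E)%E).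
      by apply: hc => i; have /andP[] := xs1 i.
    apply: ge0_le_integral_nomeas => nn _; first by rewrite lee_fin.
    by rewrite sub0r dotNr normrN.
apply: (@le_trans _ _ (\int[lebesgue_measure]_(t in `[0%R, +oo[)
    ((e * c)%:E * (\1_(`[0%R, 1%R]%classic : set R) t)%:E))%E).
  rewrite ge0_integralZl_EFin//; last 2 first.
  - by apply/measurable_EFinP; exact: measurable_indic.
  - by rewrite mulr_ge0// ltW.
  rewrite integral_indic// setIidl; last first.
    by move=> t; rewrite /= !in_itv/= andbT => /andP[].
  rewrite [X in (_ * X)%E](_ : _ = 1%E) ?mule1//.
  have := lebesgue_measure_itv (Interval (BLeft (0 : R)) (BRight 1%R)).
  by rewrite /= lte_fin ltr01 -EFinB subr0.
apply: ge0_le_integral_nomeas => t.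
  by move=> _; rewrite mule_ge0 ?lee_fin// mulr_ge0// ltW.
move=> _; rewrite indicE; case: (boolP (t \in _)) => [/set_mem|_].
  by rewrite /= in_itv mule1 => /Qge.
by rewrite mule0 Qloss_gaussian_ge0.
Qed.

(** [bounded_set] refers to the sup norm; passing to the Euclidean norm costs a factor sqrt n. *)
Lemma bounded_set_enorm (D : set 'rV[R]_n) : bounded_set D ->
  exists M : R, forall x, D x -> enorm x <= M.
Proof.
case=> M [_ /(_ (M + 1))]; rewrite ltrDl => /(_ ltr01) DM.
exists (Num.sqrt (n%:R * (M + 1) ^+ 2)) => x Dx.
rewrite -[leLHS](ger0_norm (enorm_ge0 _)) -sqrtr_sqr ler_wsqrtr//.
apply: sqr_enorm_le_card => i; apply: le_trans (DM x Dx).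
rewrite [leRHS]mx_normrE.
exact: (le_bigmax _ (fun ij : 'I_1 * 'I_n => `|x ij.1 ij.2|) (ord0, i)).
Qed.

Lemma gaussian_tail_cvg (D : set 'rV[R]_n) : (0 < n)%N -> bounded_set D ->
  (flux_sup Qgain (@gaussian R n) \1_D z + flux_sup Qloss (@gaussian R n) \1_D z)%E
     @[z --> +oo%R] --> 0%E.
Proof.
move=> n0 /bounded_set_enorm[M DM].
(* Here r stands for sqrt z: the bound of [ray_integral_tail] with d = 1 / r, so that z d = r, times
   V and doubled for gain plus loss. *)
pose b (r : R) : R := 2 * (V * (pi * (2 * r^-1) ^+ n +
  (pi / 2 - atan (r - M)) * Num.sqrt pi ^+ n)).
have cb : b r @[r --> +oo] --> (0 : R).
  have -> : (0 : R) = 2 * (V * (pi * (2 * 0) ^+ n + (pi / 2 - pi / 2) * Num.sqrt pi ^+ n)).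
    by rewrite subrr mulr0 expr0n -(negbK (n == 0)%N) -lt0n n0 !(mulr0,mul0r,addr0).
  do 2 apply: cvgMr; apply: cvgD.
    apply: cvgMr.
    apply: (@cvg_comp _ _ _ (fun r : R => 2 * r^-1) (fun s : R => s ^+ n) _ (nbhs (2 * 0 : R))).
      by apply: cvgMr; apply/gtr0_cvgV0; [near=> r|exact: cvg_id].
    exact: exprn_continuous.
  apply: cvgMl; apply: cvgB; first exact: cvg_cst.
  apply: (@cvg_comp _ _ _ (fun r : R => r - M) atan _ +oo); last exact: cvgy_atan.
  by apply/cvgryPge => A; near=> r; rewrite lerBrDr.
have csqrt : Num.sqrt z @[z --> +oo] --> (+oo : set_system R).
  apply/cvgryPge => A; near=> z.
  by rewrite (le_trans (ler_norm A))// -sqrtr_sqr ler_wsqrtr.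
have cbs : (b (Num.sqrt z))%:E @[z --> +oo] --> 0%E.
  apply: cvg_EFin; first by near=> z.
  exact: cvg_comp csqrt cb.
apply: squeeze_cvge (cvg_cst 0%E) cbs; near=> z.
have z0 : 0 < z by [].
have sz0 : 0 < Num.sqrt z by rewrite sqrtr_gt0.
have D0 (y : 'rV[R]_n) : 0 <= (\1_D y : R) by [].
rewrite flux_sup_addE adde_ge0 ?flux_sup_gaussian_ge0//=.
rewrite /b mulr2n mulrDl mul1r EFinD.
suff h : (flux_sup Qloss (@gaussian R n) \1_D z <= (V * (pi * (2 * (Num.sqrt z)^-1) ^+ n +
  (pi / 2 - atan (Num.sqrt z - M)) * Num.sqrt pi ^+ n))%:E)%E by exact: leeD.
apply: flux_sup_gaussian_le => // x xi; rewrite indicE.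
case: (boolP (x \in D)) => [/set_mem Dx|_].
  have -> : Num.sqrt z - M = z * (Num.sqrt z)^-1 - M.
    by rewrite -[X in X / _](@sqr_sqrtr _ z) ?ltW// expr2 mulfK// gt_eqF.
  rewrite mul1e; apply: ray_integral_tail; [exact: ltW| |exact: DM].
  by rewrite invr_ge0 ltW.
(* Off D the weight vanishes, and only nonnegativity of the bound is left. *)
have si0 : 0 <= 2 * (Num.sqrt z)^-1 by rewrite mulr_ge0// invr_ge0 ltW.
have at0 : 0 <= pi / 2 - atan (Num.sqrt z - M) by rewrite subr_ge0 ltW// atan_ltpi2.
by rewrite mul0e lee_fin addr_ge0// mulr_ge0 ?pi_ge0 ?exprn_ge0 ?sqrtr_ge0.
Unshelve. all: by end_near. Qed.

End gaussian_flux.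

Theorem theorem4p2 (R : realType) (n : nat) (hn : (0 < n)%N) :
  [/\ scattering_frame (@gaussian R n),
      exists alpha : R, isotropic_radius (@gaussian R n) alpha,
      (sphere_volume R n * Omega R n < +oo)%E &
      forall alpha : R, isotropic_radius (@gaussian R n) alpha ->
        (1 / (4 * sphere_volume R n * Omega R n) <= alpha%:E)%E].
Proof.
have FC0 := @frame_constant_gaussian_gt0 R n hn.
have FCle := @frame_constant_gaussian_le R n.
have FClty := le_lt_trans FCle (ltry _).
have VE := @sphere_volumeE R n.
have OE : Omega R n = (fine (Omega R n))%:E.
  by rewrite fineK// ge0_fin_numE ?Omega_lty ?Omega_ge0.
split.
- split => //.
  + by apply: measurable_funTS; exact: measurable_gaussian.
  + by move=> x xi; exact: gaussian_gt0.
  + exact: gaussian_transport_solution.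
  + by move=> D; exact: gaussian_tail_cvg.
- have FCE : frame_constant (@gaussian R n) = (fine (frame_constant (@gaussian R n)))%:E.
    by rewrite fineK// ge0_fin_numE ?ltW.
  have F0 : 0 < fine (frame_constant (@gaussian R n)) by rewrite -lte_fin -FCE.
  (* With F the frame constant, finite and positive, alpha = 1 / (2 F) solves 1 / (2 alpha) = F. *)
  have E : 1 / (2 * (1 / (2 * fine (frame_constant (@gaussian R n))))) =
      fine (frame_constant (@gaussian R n)) by field; rewrite gt_eqF.
  by exists (1 / (2 * fine (frame_constant (@gaussian R n)))); split; rewrite E.
- by rewrite VE OE -EFinM ltry.
- move=> alpha [a0 aE].
  have al0 : 0 < alpha by move: a0; rewrite div1r invr_gt0 pmulr_rgt0.
  move: FCle; rewrite -aE lee_fin => h; rewrite VE OE -!EFinM div1e.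
  set p := fine (sphere_volume R n) * _ in h.
  (* Since 0 < 1 / (2 alpha) <= 2 p, the zero case of the inverse on [\bar R] is excluded. *)
  have p0 : 0 < p by move: (lt_le_trans a0 h); rewrite pmulr_rgt0.
  have q0 : 0 < 4 * p by rewrite mulr_gt0.
  have b0 : 0 < 2 * alpha by rewrite mulr_gt0.
  rewrite -mulrA -/p inver gt_eqF// lee_fin -[leLHS]mul1r ler_pdivrMr//.
  by move: h; rewrite ler_pdivrMr//; lra.
Qed.
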